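(* Let $X$ be a subsequence invariant sequence class not contained in $c_0^w$ (that is, $X(E)\not\subseteq c_0^w(E)$ for some Banach space $E$). Then, for any $1\le p<\infty$, the ideal of bilinear operators $\Pi_{\ell_p^w,X;\ell_p(\cdot)}$ is not symmetric.
   Context: Banach spaces are over $\mathbb{K}=\mathbb{R}$ or $\mathbb{C}$; $\mathcal{L}(E_1,\ldots,E_n;F)$ is the space of continuous $n$-linear operators. $c_{00}(E)$ and $\ell_\infty(E)$ are the spaces of eventually null and of bounded $E$-valued sequences (the latter with the sup norm); $c_0^w(E)$, $\ell_p(E)$, $\ell_p^w(E)$ are the spaces of weakly null, absolutely $p$-summable, and weakly $p$-summable $E$-valued sequences with their usual norms. $E\stackrel{1}{\hookrightarrow}F$ means that $E$ is a linear subspace of $F$ and $\|\cdot\|_F\le\|\cdot\|_E$ on $E$. Sequence class: a rule $X$ assigning to each Banach space $E$ a Banach space $X(E)$ of $E$-valued sequences such that $c_{00}(E)\subseteq X(E)\stackrel{1}{\hookrightarrow}\ell_\infty(E)$ and $\|e_j\|_{X(\mathbb{K})}=1$ for every $j\in\mathbb{N}$, where $e_j$ is the $j$-th canonical unit scalar sequence. The rules $\ell_p(\cdot)$, $\ell_p^w$, $c_0^w$ are sequence classes. Given sequence classes $X_1,\ldots,X_n,Y$, an operator $A\in\mathcal{L}(E_1,\ldots,E_n;F)$ is $(X_1,\ldots,X_n;Y)$-summing, written $A\in\Pi_{X_1,\ldots,X_n;Y}(E_1,\ldots,E_n;F)$, if $(A(x_j^1,\ldots,x_j^n))_{j=1}^\infty\in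 Y(F)$ whenever $(x_j^k)_{j=1}^\infty\in X_k(E_k)$, $k=1,\ldots,n$. Its norm is the norm of the induced continuous $n$-linear operator $X_1(E_1)\times\cdots\times X_n(E_n)\to Y(F)$. Standing assumption: every sequence class $X$ is linearly stable, i.e. $\Pi_{X;X}(E;F)=\mathcal{L}(E;F)$ with equal norms for all Banach spaces $E,F$. A bilinear ideal $\Pi_{X_1,X_2;Y}$ is symmetric if, for all Banach spaces $E,F$, $A\in\Pi_{X_1,X_2;Y}(E,E;F)$ implies $A_s\in\Pi_{X_1,X_2;Y}(E,E;F)$, where $A_s(x,y)=\frac12(A(x,y)+A(y,x))$; equivalently, $A^t\in\Pi_{X_1,X_2;Y}(E,E;F)$, where $A^t(x,y)=A(y,x)$. $X$ is subsequence invariant if, for every $E$, $(x_j)_{j=1}^\infty\in X(E)$ implies that every subsequence $(x_{j_k})_{k=1}^\infty$ belongs to $X(E)$ and $\|(x_{j_k})_{k}\|_{X(E)}\le\|(x_j)_{j}\|_{X(E)}$. *)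

(* Defs.v *)
From Stdlib Require Import Reals.
From Coquelicot Require Import Coquelicot.
Open Scope R_scope.

Inductive scalar_field : Set := RealScalars | ComplexScalars.

Definition scalar_ring (k : scalar_field) : AbsRing :=
  match k with
  | RealScalars => R_AbsRing
  | ComplexScalars => C_AbsRing
  end.

Definition Banach (k : scalar_field) := CompleteNormedModule (scalar_ring k).

Definition scalar_space (k : scalar_field) : Banach k :=
  match k return Banach k with
  | RealScalars => R_CompleteNormedModule
  | ComplexScalars => C_CompleteNormedModule
  end.

(* [scalar_space k] and [scalar_ring k] have convertible carriers only once [k]
   is known, so the scalar 1 seen as a vector needs its own name. *)
Definition scalar_one (k : scalar_field) : scalar_space k :=
  match k return scalar_space k with
  | RealScalars => 1
  | ComplexScalars => RtoC 1
  end.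

Definition scalar_half (k : scalar_field) : scalar_ring k :=
  match k return scalar_ring k with
  | RealScalars => 1 / 2
  | ComplexScalars => RtoC (1 / 2)
  end.

Definition unit_seq (k : scalar_field) (j i : nat) : scalar_space k :=
  if Nat.eqb i j then scalar_one k else zero.

Definition eventually_null {k : scalar_field} {E : Banach k} (x : nat -> E) : Prop :=
  exists N : nat, forall j : nat, (N <= j)%nat -> x j = zero.

Definition sup_norm {k : scalar_field} {E : Banach k} (x : nat -> E) : Rbar :=
  Sup_seq (fun j => Finite (norm (x j))).

(* The Banach space X(E) of E-valued sequences is a Banach space [sc_space E]
   together with the linear injection [sc_coord] of [sc_space E] into the space
   of all E-valued sequences; X(E), as a set of sequences, is its range.
   [sc_sup] contains the boundedness of the sequences of X(E), since its right
   hand side is finite. *)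
Record seq_class (k : scalar_field) := {
  sc_space : Banach k -> Banach k;
  sc_coord : forall E : Banach k, sc_space E -> nat -> E;
  sc_plus : forall (E : Banach k) (s t : sc_space E) (j : nat),
    sc_coord E (plus s t) j = plus (sc_coord E s j) (sc_coord E t j);
  sc_scal : forall (E : Banach k) (a : scalar_ring k) (s : sc_space E) (j : nat),
    sc_coord E (scal a s) j = scal a (sc_coord E s j);
  sc_inj : forall (E : Banach k) (s t : sc_space E),
    (forall j : nat, sc_coord E s j = sc_coord E t j) -> s = t;
  sc_c00 : forall (E : Banach k) (x : nat -> E), eventually_null x ->
    exists s : sc_space E, forall j : nat, sc_coord E s j = x j;
  sc_sup : forall (E : Banach k) (s : sc_space E),
    Rbar_le (sup_norm (sc_coord E s)) (Finite (norm s));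
  sc_unit : forall j : nat, exists s : sc_space (scalar_space k),
    (forall i : nat, sc_coord (scalar_space k) s i = unit_seq k j i) /\ norm s = 1
}.

Arguments sc_space {k}.
Arguments sc_coord {k} X {E} s j : rename.

(* A rule assigning to each Banach space E a set of E-valued sequences.  Being
   summing, as opposed to the summing norm, only depends on these sets. *)
Definition seq_rule (k : scalar_field) := forall E : Banach k, (nat -> E) -> Prop.

Definition sc_rule {k : scalar_field} (X : seq_class k) : seq_rule k :=
  fun E x => exists s : sc_space X E, forall j : nat, sc_coord X s j = x j.

Coercion sc_rule : seq_class >-> seq_rule.

(* [Rpower 0 p] is 1, whereas 0 to a positive power must be 0. *)
Definition pow_nonneg (r p : R) : R :=
  if Req_EM_T r 0 then 0 else Rpower r p.

Definition ell (k : scalar_field) (p : R) : seq_rule k :=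
  fun E x => ex_series (fun j => pow_nonneg (norm (x j)) p).

Definition ell_w (k : scalar_field) (p : R) : seq_rule k :=
  fun E x => forall phi : E -> scalar_space k, is_linear phi ->
    ell k p (scalar_space k) (fun j => phi (x j)).

Definition c0_w (k : scalar_field) : seq_rule k :=
  fun E x => forall phi : E -> scalar_space k, is_linear phi ->
    filterlim (fun j => phi (x j)) eventually (locally (zero : scalar_space k)).

(* [is_linear] includes boundedness. *)
Definition summing {k : scalar_field} (X Y : seq_rule k) (E F : Banach k)
    (u : E -> F) : Prop :=
  is_linear u /\ forall x : nat -> E, X E x -> Y F (fun j => u (x j)).

Definition op_norm {k : scalar_field} {E F : Banach k} (u : E -> F) : Rbar :=
  Lub_Rbar (fun r => exists x : E, norm x <= 1 /\ r = norm (u x)).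

(* The operator norm of the induced operator from X(E) to Y(F). *)
Definition summing_norm {k : scalar_field} (X Y : seq_class k) (E F : Banach k)
    (u : E -> F) : Rbar :=
  Lub_Rbar (fun r => exists (s : sc_space X E) (t : sc_space Y F),
    norm s <= 1 /\ (forall j : nat, sc_coord Y t j = u (sc_coord X s j)) /\
    r = norm t).

Definition linearly_stable {k : scalar_field} (X : seq_class k) : Prop :=
  forall (E F : Banach k) (u : E -> F),
    (summing X X E F u <-> is_linear u) /\
    (is_linear u -> summing_norm X X E F u = op_norm u).

Definition subsequence_invariant {k : scalar_field} (X : seq_class k) : Prop :=
  forall (E : Banach k) (s : sc_space X E) (sigma : nat -> nat),
    (forall i j : nat, (i < j)%nat -> (sigma i < sigma j)%nat) ->
    exists t : sc_space X E,
      (forall j : nat, sc_coord X t j = sc_coord X s (sigma j)) /\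
      norm t <= norm s.

Record continuous_bilinear {k : scalar_field} {E1 E2 F : Banach k}
    (A : E1 -> E2 -> F) : Prop := {
  bilin_plus_l : forall (x x' : E1) (y : E2),
    A (plus x x') y = plus (A x y) (A x' y);
  bilin_scal_l : forall (a : scalar_ring k) (x : E1) (y : E2),
    A (scal a x) y = scal a (A x y);
  bilin_plus_r : forall (x : E1) (y y' : E2),
    A x (plus y y') = plus (A x y) (A x y');
  bilin_scal_r : forall (a : scalar_ring k) (x : E1) (y : E2),
    A x (scal a y) = scal a (A x y);
  bilin_continuous : forall z : E1 * E2,
    continuous (fun z : E1 * E2 => A (fst z) (snd z)) z
}.

Definition summing2 {k : scalar_field} (X1 X2 Y : seq_rule k)
    (E1 E2 F : Banach k) (A : E1 -> E2 -> F) : Prop :=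
  continuous_bilinear A /\
  forall (x : nat -> E1) (y : nat -> E2),
    X1 E1 x -> X2 E2 y -> Y F (fun j => A (x j) (y j)).

Definition symmetrization {k : scalar_field} {E F : Banach k}
    (A : E -> E -> F) (x y : E) : F :=
  scal (scalar_half k) (plus (A x y) (A y x)).

Definition symmetric_ideal {k : scalar_field} (X1 X2 Y : seq_rule k) : Prop :=
  forall (E F : Banach k) (A : E -> E -> F),
    summing2 X1 X2 Y E E F A -> summing2 X1 X2 Y E E F (symmetrization A).

(* Main.v *)
Require Import Defs.
From Stdlib Require Import Reals Lra Lia.
From Stdlib Require Import ClassicalEpsilon ProofIrrelevance.
From Stdlib Require Import FunctionalExtensionality PropExtensionality.
From Coquelicot Require Import Coquelicot.
Open Scope R_scope.

(** Symmetry of the ideal forces every sequence of [X(E)] to be weakly null, for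
    every [E]; this is [symmetric_ideal_weakly_null].  Everything happens on
    the space [l_oo] of bounded scalar sequences, with unit vectors [e_j].

    A product [A(f, g) = phi0(f) g] with a functional [phi0] turns a weakly
    [p]-summable sequence in its first variable and a bounded sequence in its
    second into an absolutely [p]-summable one ([summing2_scal_functional]).
    Hence the operator given by [phi0(f) = f_0] on [l_oo] belongs to the ideal.

    Let now [x] be in [X(E)] and [phi] a functional on [E].  By linear
    stability, applied to the operator [z |-> phi(z) e_0], the sequence
    [y_j = phi(x_j) e_0] is in [X(l_oo)].  The vectors [e_(j+1)] are weakly
    1-summable, because the sums [a_0 e_1 + ... + a_n e_(n+1)] with
    [|a_i| <= 1] stay in the unit ball ([unit_vectors_weakly_summable]); so they
    are weakly [p]-summable for every [p >= 1].  As [phi0(e_(j+1)) = 0], the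
    symmetrization of [A] sends [(e_(j+1), y_j)] to [1/2 phi(x_j) e_(j+1)], a
    vector of norm [|phi(x_j)| / 2].  If the symmetrization is summing, these
    norms are [p]-th power summable, and so [phi(x_j)] tends to 0. *)

(** * The Banach space of bounded functions *)

Section BoundedFunctions.

Context (T : Type) {K : AbsRing} (V : NormedModule K).

Record bfun := {
  bval :> T -> V;
  bval_bounded : exists M : R, forall t : T, norm (bval t) <= M
}.

Lemma bfun_ext (f g : bfun) : (forall t, f t = g t) -> f = g.
Proof.
  destruct f as [f Hf], g as [g Hg]; simpl; intros H.
  assert (E : f = g) by (apply functional_extensionality; exact H).
  subst g; f_equal; apply proof_irrelevance.
Qed.

Lemma bzero_bounded : exists M : R, forall t : T, norm (zero : V) <= M.
Proof. exists 0; intros _; right; exact (@norm_zero K V). Qed.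

Lemma bplus_bounded (f g : bfun) :
  exists M : R, forall t : T, norm (plus (f t) (g t)) <= M.
Proof.
  destruct (bval_bounded f) as [M HM], (bval_bounded g) as [N HN].
  exists (M + N); intros t.
  eapply Rle_trans; [apply norm_triangle | apply Rplus_le_compat; auto].
Qed.

Lemma bopp_bounded (f : bfun) : exists M : R, forall t : T, norm (opp (f t)) <= M.
Proof.
  destruct (bval_bounded f) as [M HM].
  exists M; intros t; rewrite norm_opp; auto.
Qed.

Lemma bscal_bounded (a : K) (f : bfun) :
  exists M : R, forall t : T, norm (scal a (f t)) <= M.
Proof.
  destruct (bval_bounded f) as [M HM].
  exists (abs a * M); intros t.
  eapply Rle_trans; [apply norm_scal | apply Rmult_le_compat_l; auto using abs_ge_0].
Qed.

Definition bzero : bfun := Build_bfun _ bzero_bounded.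
Definition bplus (f g : bfun) : bfun := Build_bfun _ (bplus_bounded f g).
Definition bopp (f : bfun) : bfun := Build_bfun _ (bopp_bounded f).
Definition bscal (a : K) (f : bfun) : bfun := Build_bfun _ (bscal_bounded a f).

Definition bfun_AbelianMonoid_mixin : AbelianMonoid.mixin_of bfun.
Proof.
  apply (AbelianMonoid.Mixin bfun bplus bzero);
    intros; apply bfun_ext; intros t; simpl.
  - apply plus_comm.
  - apply plus_assoc.
  - apply plus_zero_r.
Defined.

Canonical bfun_AbelianMonoid := AbelianMonoid.Pack bfun bfun_AbelianMonoid_mixin bfun.

Definition bfun_AbelianGroup_mixin : AbelianGroup.mixin_of bfun_AbelianMonoid.
Proof.
  apply (AbelianGroup.Mixin bfun_AbelianMonoid bopp).
  intros; apply bfun_ext; intros t; apply (plus_opp_r (x t)).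
Defined.

Canonical bfun_AbelianGroup :=
  AbelianGroup.Pack bfun (AbelianGroup.Class _ _ bfun_AbelianGroup_mixin) bfun.

Definition bfun_ModuleSpace_mixin : ModuleSpace.mixin_of K bfun_AbelianGroup.
Proof.
  apply (ModuleSpace.Mixin K bfun_AbelianGroup bscal);
    intros; apply bfun_ext; intros t; simpl.
  - apply scal_assoc.
  - apply (scal_one (u t)).
  - apply (scal_distr_l x (u t) (v t)).
  - apply (scal_distr_r x y (u t)).
Defined.

Canonical bfun_ModuleSpace :=
  ModuleSpace.Pack K bfun (ModuleSpace.Class _ _ _ bfun_ModuleSpace_mixin) bfun.

Definition bfun_UniformSpace_mixin : UniformSpace.mixin_of bfun.
Proof.
  apply (UniformSpace.Mixin bfun bzero
           (fun f e g => ball (f : T -> V) e (g : T -> V))).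
  - intros; apply ball_center.
  - intros; apply ball_sym; assumption.
  - intros; eapply ball_triangle; eassumption.
Defined.

Canonical bfun_UniformSpace := UniformSpace.Pack bfun bfun_UniformSpace_mixin bfun.

Canonical bfun_NormedModuleAux :=
  NormedModuleAux.Pack K bfun
    (NormedModuleAux.Class K bfun (ModuleSpace.class K bfun_ModuleSpace)
       bfun_UniformSpace_mixin) bfun.

(** The value 0 keeps the supremum real when [T] is empty. *)
Definition bnorm (f : bfun) : R :=
  real (Lub_Rbar (fun r => r = 0 \/ exists t : T, r = norm (f t))).

Lemma bnorm_lub (f : bfun) :
  0 <= bnorm f /\ (forall t : T, norm (f t) <= bnorm f) /\
  (forall M : R, 0 <= M -> (forall t : T, norm (f t) <= M) -> bnorm f <= M).
Proof.
  unfold bnorm.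
  set (S := fun r => r = 0 \/ exists t : T, r = norm (f t)).
  destruct (Lub_Rbar_correct S) as [ub lub].
  destruct (bval_bounded f) as [M HM].
  assert (H0 := ub 0 (or_introl eq_refl)).
  assert (HB : Rbar_le (Lub_Rbar S) (Finite (Rmax 0 M))).
  { apply lub; intros r [-> | [t ->]]; simpl; [apply Rmax_l |].
    eapply Rle_trans; [apply HM | apply Rmax_r]. }
  assert (HN : forall N, 0 <= N -> (forall t, norm (f t) <= N) ->
    Rbar_le (Lub_Rbar S) (Finite N)).
  { intros N N0 HN; apply lub; intros r [-> | [t ->]]; simpl; auto. }
  assert (Hf : forall t, Rbar_le (Finite (norm (f t))) (Lub_Rbar S)).
  { intros t; apply ub; right; exists t; reflexivity. }
  destruct (Lub_Rbar S) as [l | |]; simpl in *; try contradiction.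
  auto.
Qed.

Lemma bnorm_ge_0 (f : bfun) : 0 <= bnorm f.
Proof. apply bnorm_lub. Qed.

Lemma norm_le_bnorm (f : bfun) (t : T) : norm (f t) <= bnorm f.
Proof. apply bnorm_lub. Qed.

Lemma bnorm_le (f : bfun) (M : R) :
  0 <= M -> (forall t : T, norm (f t) <= M) -> bnorm f <= M.
Proof. apply bnorm_lub. Qed.

Definition bfun_NormedModule_mixin : NormedModule.mixin_of K bfun_NormedModuleAux.
Proof.
  (* A pointwise ball of radius [eps] only gives the bound
     [norm <= norm_factor * eps]; doubling the factor makes it strict. *)
  apply (NormedModule.Mixin K bfun_NormedModuleAux bnorm (2 * @norm_factor K V)).
  - intros f g; apply bnorm_le.
    + apply Rplus_le_le_0_compat; apply bnorm_ge_0.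
    + intros t; eapply Rle_trans; [apply (norm_triangle (f t) (g t)) |].
      apply Rplus_le_compat; apply norm_le_bnorm.
  - intros a f; apply bnorm_le.
    + apply Rmult_le_pos; [apply abs_ge_0 | apply bnorm_ge_0].
    + intros t; eapply Rle_trans; [apply (norm_scal a (f t)) |].
      apply Rmult_le_compat_l; [apply abs_ge_0 | apply norm_le_bnorm].
  - intros f g e H t; apply norm_compat1.
    eapply Rle_lt_trans; [apply (norm_le_bnorm (minus g f) t) | exact H].
  - intros f g e H.
    assert (P := @norm_factor_gt_0 K V).
    assert (Pe := Rmult_lt_0_compat _ _ P (cond_pos e)).
    apply Rle_lt_trans with (@norm_factor K V * e); [| lra].
    apply bnorm_le; [lra |].
    intros t; left; apply (norm_compat2 (f t) (g t)); apply H.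
  - intros f H; apply bfun_ext; intros t; apply norm_eq_zero.
    apply Rle_antisym; [rewrite <- H; apply norm_le_bnorm | apply norm_ge_0].
Defined.

Canonical bfun_NormedModule :=
  NormedModule.Pack K bfun
    (NormedModule.Class K bfun (NormedModuleAux.class K bfun_NormedModuleAux)
       bfun_NormedModule_mixin) bfun.

End BoundedFunctions.

Section Completeness.

Context (T : Type) {K : AbsRing} (V : CompleteNormedModule K).

(** The limit is the one in the complete space of all functions, whose balls are
    the same; it is bounded since it is uniformly close to a bounded function. *)
Lemma bfun_cauchy_limit (F : (bfun T V -> Prop) -> Prop) :
  ProperFilter F -> cauchy F -> exists l : bfun T V, forall eps : posreal, F (ball l eps).
Proof.
  intros PF CF.
  set (G := filtermap (fun f : bfun T V => (f : T -> V)) F).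
  assert (PG : ProperFilter G) by (apply filtermap_proper_filter; exact PF).
  assert (CG : cauchy G).
  { intros e; destruct (CF e) as [x Hx]; exists (x : T -> V); exact Hx. }
  assert (L := complete_cauchy G PG CG).
  set (h := lim G) in L.
  assert (B : exists M : R, forall t, norm (h t) <= M).
  { destruct (@filter_ex _ F PF _ (L (mkposreal 1 Rlt_0_1))) as [f Hf].
    destruct (bval_bounded T V f) as [M HM].
    exists (@norm_factor K V * 1 + M); intros t.
    replace (h t) with (plus (minus (h t) (f t)) (f t)).
    - eapply Rle_trans; [apply (@norm_triangle K V) |].
      apply Rplus_le_compat; [| apply HM].
      left; apply (@norm_compat2 K V (f t) (h t) (mkposreal 1 Rlt_0_1)).
      apply ball_sym, Hf.
    - unfold minus.
      etransitivity; [symmetry; apply (@plus_assoc V) |].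
      rewrite (@plus_opp_l V); apply (@plus_zero_r V). }
  exists (Build_bfun T V h B); intros e; exact (L e).
Qed.

(** The limit has to be a total function of the filter [F]; on filters that do
    not converge, [epsilon] returns an arbitrary bounded function. *)
Definition bfun_CompleteSpace_mixin : CompleteSpace.mixin_of (bfun_UniformSpace T V).
Proof.
  apply (CompleteSpace.Mixin (bfun_UniformSpace T V)
    (fun F => epsilon (inhabits (bzero T V))
                (fun l => forall eps : posreal, F (ball l eps)))).
  - intros F PF CF.
    exact (epsilon_spec (inhabits (bzero T V)) _ (bfun_cauchy_limit F PF CF)).
  - intros F1 F2 H12 H21.
    assert (E : F1 = F2).
    { apply functional_extensionality; intros P.
      apply propositional_extensionality; split; [apply H21 | apply H12]. }
    subst F2; intros e; apply ball_center.
Defined.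

Canonical bfun_CompleteNormedModule :=
  CompleteNormedModule.Pack K (bfun T V)
    (CompleteNormedModule.Class K (bfun T V) (NormedModule.class K (bfun_NormedModule T V))
       bfun_CompleteSpace_mixin) (bfun T V).

End Completeness.

Arguments bval {T K V} b t.
Arguments bnorm {T K V} f.
Arguments norm_le_bnorm {T K V} f t.
Arguments bnorm_le {T K V} f M.

(** * Functions carried by one point *)

Lemma spike_bounded {K : AbsRing} {V : NormedModule K} (j : nat) (v : V) :
  exists M : R, forall i : nat, norm (if Nat.eqb i j then v else zero) <= M.
Proof.
  exists (norm v); intros i; destruct (Nat.eqb i j).
  - apply Rle_refl.
  - rewrite norm_zero; apply norm_ge_0.
Qed.

Definition spike {K : AbsRing} {V : NormedModule K} (j : nat) (v : V) : bfun nat V :=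
  Build_bfun nat V _ (spike_bounded j v).

Lemma spike_same {K : AbsRing} {V : NormedModule K} (j : nat) (v : V) :
  spike j v j = v.
Proof. simpl; rewrite Nat.eqb_refl; reflexivity. Qed.

Lemma spike_other {K : AbsRing} {V : NormedModule K} (i j : nat) (v : V) :
  i <> j -> spike j v i = zero.
Proof. intros H; simpl; apply Nat.eqb_neq in H; rewrite H; reflexivity. Qed.

Lemma is_linear_spike {K : AbsRing} {V : NormedModule K} (j : nat) :
  is_linear (spike j : V -> bfun nat V).
Proof.
  split.
  - intros v w; apply bfun_ext; intros i; simpl.
    destruct (Nat.eqb i j); [reflexivity | symmetry; apply plus_zero_r].
  - intros a v; apply bfun_ext; intros i; simpl.
    destruct (Nat.eqb i j); [reflexivity | symmetry; exact (@scal_zero_r K V a)].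
  - exists 1; split; [lra |]; intros v; rewrite Rmult_1_l.
    apply bnorm_le; [apply norm_ge_0 |]; intros i; simpl.
    destruct (Nat.eqb i j); [lra | rewrite norm_zero; apply norm_ge_0].
Qed.

Lemma is_linear_eval {T : Type} {K : AbsRing} {V : NormedModule K} (t : T) :
  is_linear (fun f : bfun T V => f t).
Proof.
  split; try reflexivity.
  exists 1; split; [lra |]; intros f; rewrite Rmult_1_l; apply norm_le_bnorm.
Qed.

Lemma linear_sum_n {K : AbsRing} {U V : NormedModule K} (l : U -> V) (x : nat -> U)
    (n : nat) :
  is_linear l -> l (sum_n x n) = sum_n (fun j => l (x j)) n.
Proof.
  intros Hl; induction n as [| n IH].
  - rewrite !sum_O; reflexivity.
  - rewrite !sum_Sn, (linear_plus l Hl), IH; reflexivity.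
Qed.

(** Spikes at distinct points have disjoint supports: at each point at most one
    term of the sum is nonzero. *)
Lemma norm_sum_spikes_le {K : AbsRing} {V : NormedModule K} (sigma : nat -> nat)
    (v : nat -> V) (C : R) (n : nat) :
  (forall i j, sigma i = sigma j -> i = j) ->
  (forall j, norm (v j) <= C) ->
  norm (sum_n (fun j => spike (sigma j) (v j)) n) <= C.
Proof.
  intros Hs HC.
  assert (C0 : 0 <= C) by exact (Rle_trans _ _ _ (norm_ge_0 (v O)) (HC O)).
  (* The second part, that the sum vanishes off the points used so far, carries
     the induction when the next spike sits at [i]. *)
  assert (H : forall i, norm (sum_n (fun j => spike (sigma j) (v j) i) n) <= C /\
     ((forall j, (j <= n)%nat -> i <> sigma j) ->
       sum_n (fun j => spike (sigma j) (v j) i) n = zero)).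
  { intros i; induction n as [| n [IHb IHz]].
    - rewrite sum_O; split.
      + destruct (Nat.eq_dec i (sigma O)) as [-> | Hi].
        * rewrite spike_same; apply HC.
        * rewrite spike_other by exact Hi; rewrite norm_zero; exact C0.
      + intros Hj; apply spike_other, Hj; lia.
    - rewrite sum_Sn; split.
      + destruct (Nat.eq_dec i (sigma (S n))) as [-> | Hi].
        * rewrite IHz, plus_zero_l, spike_same; [apply HC |].
          intros j Hj E; apply Hs in E; lia.
        * rewrite (spike_other i) by exact Hi; rewrite plus_zero_r; exact IHb.
      + intros Hj; rewrite IHz by (intros; apply Hj; lia).
        rewrite spike_other by (apply Hj; lia); apply plus_zero_r. }
  apply bnorm_le; [exact C0 |]; intros i.
  rewrite (linear_sum_n (fun f : bfun nat V => f i)) by apply is_linear_eval.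
  apply H.
Qed.

(** * Real and complex scalars *)

(** The identity, from the field seen as a vector space to the field seen as a
    ring. *)
Definition scalar_val (k : scalar_field) : scalar_space k -> scalar_ring k :=
  match k return scalar_space k -> scalar_ring k with
  | RealScalars => fun v => v
  | ComplexScalars => fun v => v
  end.

Lemma is_linear_scalar_val (k : scalar_field) :
  is_linear (scalar_val k : scalar_space k -> AbsRing_NormedModule (scalar_ring k)).
Proof.
  destruct k; split; try reflexivity; exists 1; (split; [lra |]); intros v;
    rewrite Rmult_1_l; apply Rle_refl.
Qed.

Lemma abs_scalar_val (k : scalar_field) (v : scalar_space k) :
  abs (scalar_val k v) = norm v.
Proof. destruct k; reflexivity. Qed.

Lemma scal_scalar_one (k : scalar_field) (v : scalar_space k) :
  scal (scalar_val k v) (scalar_one k) = v.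
Proof. destruct k; [apply Rmult_1_r | apply Cmult_1_r]. Qed.

Lemma norm_scalar_one (k : scalar_field) : norm (scalar_one k) = 1.
Proof. destruct k; [apply Rabs_R1 | apply Cmod_1]. Qed.

Lemma norm_scal_scalar (k : scalar_field) (a : scalar_ring k) (v : scalar_space k) :
  norm (scal a v) = abs a * norm v.
Proof. destruct k; [apply Rabs_mult | apply Cmod_mult]. Qed.

Lemma abs_scalar_half (k : scalar_field) : abs (scalar_half k) = 1 / 2.
Proof.
  destruct k; [| etransitivity; [apply Cmod_R |]]; apply Rabs_pos_eq; lra.
Qed.

(** The embedding of the reals into the field. *)
Definition real_scalar (k : scalar_field) (r : R) : scalar_space k :=
  match k return scalar_space k with
  | RealScalars => r
  | ComplexScalars => RtoC r
  end.

Lemma norm_real_scalar (k : scalar_field) (r : R) : norm (real_scalar k r) = Rabs r.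
Proof. destruct k; [reflexivity | apply Cmod_R]. Qed.

Lemma sum_n_real_scalar (k : scalar_field) (r : nat -> R) (n : nat) :
  sum_n (fun j => real_scalar k (r j)) n = real_scalar k (sum_n r n).
Proof.
  induction n as [| n IH]; [rewrite !sum_O; reflexivity |].
  rewrite !sum_Sn, IH; destruct k; [reflexivity | symmetry; apply RtoC_plus].
Qed.

(** The witness is the sign of a real [v], and [conj v / |v|] for a nonzero
    complex [v]. *)
Lemma scalar_phase (k : scalar_field) (v : scalar_space k) :
  exists a : scalar_ring k, abs a <= 1 /\ scal a v = real_scalar k (norm v).
Proof.
  destruct k.
  - destruct (Rle_dec 0 v) as [H | H].
    + exists 1; split; [right; apply Rabs_R1 |].
      etransitivity; [apply Rmult_1_l | symmetry; apply Rabs_pos_eq, H].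
    + exists (-1); split.
      * right; etransitivity; [apply Rabs_left; lra | lra].
      * etransitivity; [| symmetry; apply Rabs_left; lra].
        change (-1 * v = - v); ring.
  - destruct (Ceq_dec v 0) as [-> | H].
    + exists (RtoC 0); split.
      * left; eapply Rle_lt_trans; [apply Req_le, Cmod_0 | lra].
      * change (0 * 0 = Cmod 0)%C; rewrite Cmod_0; ring.
    + assert (Hm : Cmod v <> 0) by (intros E; apply H, Cmod_eq_0, E).
      exists (Cconj v / Cmod v)%C; split.
      * right; change (Cmod (Cconj v / Cmod v) = 1).
        rewrite Cmod_div, Cmod_conj, Cmod_R, Rabs_pos_eq by
         (try apply Cmod_ge_0; intros E; apply Hm, RtoC_inj, E).
        field; exact Hm.
      * change (Cconj v / Cmod v * v = Cmod v)%C.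
        assert (Hm' : RtoC (Cmod v) <> 0) by (intros E; apply Hm, RtoC_inj, E).
        replace (Cconj v / Cmod v * v)%C with (v * Cconj v / Cmod v)%C
          by (field; exact Hm').
        rewrite <- Cmod2_conj; simpl; rewrite Rmult_1_r, RtoC_mult; field; exact Hm'.
Qed.

(** * Summability of sequences *)

(** Choosing [a_j] with [a_j phi(x_j) = |phi(x_j)|] writes the partial sums of
    [|phi(x_j)|] as values of [phi] on vectors of norm at most [C]. *)
Lemma weakly_1_summable (k : scalar_field) (E : Banach k) (x : nat -> E) (C : R) :
  (forall (a : nat -> scalar_ring k) (n : nat), (forall j, abs (a j) <= 1) ->
     norm (sum_n (fun j => scal (a j) (x j)) n) <= C) ->
  forall phi : E -> scalar_space k, is_linear phi ->
    ex_series (fun j => norm (phi (x j))).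
Proof.
  intros HC phi Hphi.
  destruct (linear_norm phi Hphi) as [M [M0 HM]].
  set (P := fun j (a : scalar_ring k) =>
    abs a <= 1 /\ scal a (phi (x j)) = real_scalar k (norm (phi (x j)))).
  set (a := fun j => epsilon (inhabits zero) (P j)).
  assert (Ha : forall j, P j (a j)).
  { intros j; apply epsilon_spec, scalar_phase. }
  assert (L : ex_finite_lim_seq (sum_n (fun j => norm (phi (x j))))).
  { apply ex_finite_lim_seq_incr with (M * C).
    - intros n; rewrite sum_Sn.
      rewrite <- (Rplus_0_r (sum_n _ n)) at 1.
      apply Rplus_le_compat_l, norm_ge_0.
    - intros n.
      apply Rle_trans with (norm (phi (sum_n (fun j => scal (a j) (x j)) n))).
      + rewrite (linear_sum_n phi) by exact Hphi.
        rewrite (sum_n_ext _ (fun j => real_scalar k (norm (phi (x j))))).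
        * rewrite sum_n_real_scalar, norm_real_scalar; apply Rle_abs.
        * intros j; rewrite (linear_scal phi Hphi); apply Ha.
      + eapply Rle_trans; [apply HM |].
        apply Rmult_le_compat_l; [lra |]; apply HC; intros j; apply Ha. }
  destruct L as [l Hl]; exists l; exact Hl.
Qed.

Lemma pow_nonneg_ge_0 (r p : R) : 0 <= pow_nonneg r p.
Proof.
  unfold pow_nonneg; destruct (Req_EM_T r 0); [lra | left; apply exp_pos].
Qed.

Lemma pow_nonneg_le (r s p : R) :
  0 <= p -> 0 <= r <= s -> pow_nonneg r p <= pow_nonneg s p.
Proof.
  intros Hp [Hr Hs]; unfold pow_nonneg at 1.
  destruct (Req_EM_T r 0); [apply pow_nonneg_ge_0 |].
  unfold pow_nonneg; destruct (Req_EM_T s 0); [lra |].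
  apply Rle_Rpower_l; lra.
Qed.

Lemma pow_nonneg_mult (r s p : R) :
  0 <= r -> 0 <= s -> pow_nonneg (r * s) p = pow_nonneg r p * pow_nonneg s p.
Proof.
  intros Hr Hs; unfold pow_nonneg.
  destruct (Req_EM_T r 0) as [-> | Nr].
  { destruct (Req_EM_T (0 * s) 0); lra. }
  destruct (Req_EM_T s 0) as [-> | Ns].
  { destruct (Req_EM_T (r * 0) 0); lra. }
  destruct (Req_EM_T (r * s) 0) as [E | _].
  { apply Rmult_integral in E; tauto. }
  symmetry; apply Rpower_mult_distr; lra.
Qed.

(** From [r^p = r^(p-1) r]: this is how summability passes from exponent 1 to
    exponent [p]. *)
Lemma pow_nonneg_le_linear (r B p : R) :
  1 <= p -> 0 <= r <= B -> 0 < B -> pow_nonneg r p <= Rpower B (p - 1) * r.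
Proof.
  intros Hp Hr HB; unfold pow_nonneg; destruct (Req_EM_T r 0) as [-> | N]; [lra |].
  replace p with ((p - 1) + 1) at 1 by ring.
  rewrite Rpower_plus, (Rpower_1 r) by lra.
  apply Rmult_le_compat_r; [lra |]; apply Rle_Rpower_l; lra.
Qed.

Lemma ex_series_le_R (a b : nat -> R) :
  (forall n, 0 <= a n <= b n) -> ex_series b -> ex_series a.
Proof.
  intros H; apply (@ex_series_le R_AbsRing R_CompleteNormedModule).
  intros n; change (Rabs (a n) <= b n); rewrite Rabs_pos_eq; apply H.
Qed.

Lemma ell_of_ell_1 (k : scalar_field) (p : R) (E : Banach k) (x : nat -> E) :
  1 <= p -> ex_series (fun j => norm (x j)) -> ell k p E x.
Proof.
  intros Hp Hx.
  (* A bound of at least 1, since [Rpower] needs a positive base. *)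
  destruct (filterlim_bounded _ (ex_intro _ 0 (ex_series_lim_0 _ Hx))) as [M HM].
  assert (HM' : forall j, norm (x j) <= Rmax M 1).
  { intros j; eapply Rle_trans; [| apply Rmax_l].
    eapply Rle_trans; [apply Rle_abs | apply HM]. }
  apply ex_series_le_R with (fun j => Rpower (Rmax M 1) (p - 1) * norm (x j)).
  - intros j; split; [apply pow_nonneg_ge_0 |].
    apply pow_nonneg_le_linear; [exact Hp | split; [apply norm_ge_0 | apply HM'] |].
    apply Rlt_le_trans with 1; [lra | apply Rmax_r].
  - exact (@ex_series_scal_l R_AbsRing R_NormedModule _ _ Hx).
Qed.

Lemma ell_dominated (k : scalar_field) (p C : R) (E F : Banach k) (x : nat -> E)
    (y : nat -> F) :
  0 <= p -> 0 <= C -> (forall j, norm (y j) <= C * norm (x j)) ->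
  ell k p E x -> ell k p F y.
Proof.
  intros Hp HC H Hx.
  apply ex_series_le_R with (fun j => pow_nonneg C p * pow_nonneg (norm (x j)) p).
  - intros j; split; [apply pow_nonneg_ge_0 |].
    rewrite <- pow_nonneg_mult by (try apply norm_ge_0; exact HC).
    apply pow_nonneg_le; [exact Hp | split; [apply norm_ge_0 | apply H]].
  - exact (@ex_series_scal_l R_AbsRing R_NormedModule _ _ Hx).
Qed.

Lemma ell_norm_lim_0 (k : scalar_field) (p : R) (E : Banach k) (x : nat -> E) :
  0 <= p -> ell k p E x -> is_lim_seq (fun j => norm (x j)) 0.
Proof.
  intros Hp Hx; apply is_lim_seq_spec; intros eps.
  apply ex_series_lim_0, is_lim_seq_spec in Hx.
  assert (He := cond_pos eps).
  destruct (Hx (mkposreal (Rpower eps p) (exp_pos _))) as [N HN].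
  exists N; intros j Hj; specialize (HN j Hj); simpl in HN.
  rewrite Rminus_0_r in *.
  rewrite Rabs_pos_eq in * by (try apply pow_nonneg_ge_0; apply norm_ge_0).
  apply Rnot_le_lt; intros Hle.
  apply (Rlt_not_le _ _ HN).
  replace (Rpower eps p) with (pow_nonneg eps p).
  - apply pow_nonneg_le; [exact Hp | lra].
  - unfold pow_nonneg; destruct (Req_EM_T eps 0); [lra | reflexivity].
Qed.

Lemma norm_lim_0 {K : AbsRing} {V : NormedModule K} (x : nat -> V) :
  is_lim_seq (fun j => norm (x j)) 0 -> filterlim x eventually (locally (zero : V)).
Proof.
  intros H; apply is_lim_seq_spec in H.
  apply filterlim_locally; intros eps.
  destruct (H eps) as [N HN]; exists N; intros j Hj.
  apply norm_compat1.
  eapply Rle_lt_trans; [apply Req_le, (f_equal norm), (@minus_zero_r V (x j)) |].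
  specialize (HN j Hj); rewrite Rminus_0_r, Rabs_pos_eq in HN by apply norm_ge_0.
  exact HN.
Qed.

(** * The operator and its symmetrization *)

Lemma continuous_bilinear_scal_functional (k : scalar_field) (E F : Banach k)
    (phi : E -> AbsRing_NormedModule (scalar_ring k)) :
  is_linear phi ->
  continuous_bilinear (fun (x : E) (y : F) => scal (phi x : scalar_ring k) y).
Proof.
  intros Hphi.
  assert (comm : forall a b : scalar_ring k, mult a b = mult b a).
  { destruct k; [exact Rmult_comm | exact Cmult_comm]. }
  split.
  - intros x x' y; rewrite (linear_plus phi Hphi); apply (scal_distr_r (phi x) (phi x') y).
  - intros a x y; rewrite (linear_scal phi Hphi); symmetry; apply (scal_assoc a (phi x) y).
  - intros x y y'; apply (scal_distr_l (phi x) y y').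
  - intros a x y.
    etransitivity; [apply (scal_assoc (phi x) a y) |].
    rewrite comm; symmetry; apply (scal_assoc a (phi x) y).
  - intros z; apply (continuous_scal (fun z : E * F => phi (fst z)) (fun z => snd z)).
    + apply continuous_comp; [apply continuous_fst |]; exact (linear_cont phi (fst z) Hphi).
    + apply continuous_snd.
Qed.

Lemma seq_class_bounded (k : scalar_field) (X : seq_class k) (E : Banach k) (x : nat -> E) :
  sc_rule X E x -> exists C : R, 0 <= C /\ forall j, norm (x j) <= C.
Proof.
  intros [s Hs]; exists (norm s); split; [apply norm_ge_0 |]; intros j.
  assert (H : Rbar_le (Finite (norm (sc_coord X s j))) (Finite (norm s))).
  { eapply Rbar_le_trans; [| apply (sc_sup _ X E s)].
    apply (Sup_seq_minor_le _ _ j), Rbar_le_refl. }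
  rewrite Hs in H; exact H.
Qed.

(** The first factor supplies the [p]-summability, and the second one only has to
    be bounded, as every sequence of a sequence class is. *)
Lemma summing2_scal_functional (k : scalar_field) (X : seq_class k) (p : R) (E F : Banach k)
    (phi : E -> scalar_space k) :
  0 <= p -> is_linear phi ->
  summing2 (ell_w k p) X (ell k p) E F F (fun x y => scal (scalar_val k (phi x)) y).
Proof.
  intros Hp Hphi; split.
  - apply (continuous_bilinear_scal_functional k E F (fun x => scalar_val k (phi x))).
    apply (is_linear_comp phi (scalar_val k)); [exact Hphi | apply is_linear_scalar_val].
  - intros x y Hx Hy.
    destruct (seq_class_bounded k X F y Hy) as [C [C0 HC]].
    apply (ell_dominated k p C (scalar_space k) F (fun j => phi (x j)));
      [exact Hp | exact C0 | | apply Hx, Hphi].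
    intros j; eapply Rle_trans; [apply (@norm_scal _ F) |].
    rewrite abs_scalar_val, Rmult_comm.
    apply Rmult_le_compat_r; [apply norm_ge_0 | apply HC].
Qed.

Definition ell_infty (k : scalar_field) : Banach k :=
  bfun_CompleteNormedModule nat (scalar_space k).

Definition unit_vector (k : scalar_field) (j : nat) : ell_infty k :=
  spike j (scalar_one k).

(** These vectors have norm 1 and so are not absolutely summable: the gap between
    weak and absolute summability that the symmetrization exposes. *)
Lemma unit_vectors_weakly_summable (k : scalar_field) (p : R) (sigma : nat -> nat) :
  1 <= p -> (forall i j, sigma i = sigma j -> i = j) ->
  ell_w k p (ell_infty k) (fun j => unit_vector k (sigma j)).
Proof.
  intros Hp Hs phi Hphi; apply ell_of_ell_1; [exact Hp |].
  apply (weakly_1_summable k (ell_infty k) _ 1); [| exact Hphi].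
  intros a n Ha.
  rewrite (sum_n_ext _ (fun j => spike (sigma j) (scal (a j) (scalar_one k)) : ell_infty k)).
  - apply (norm_sum_spikes_le sigma); [exact Hs |].
    intros j; rewrite norm_scal_scalar, norm_scalar_one, Rmult_1_r; apply Ha.
  - intros j; symmetry; exact (linear_scal _ (is_linear_spike (sigma j)) (a j) (scalar_one k)).
Qed.

(** Symmetry lets one test [A] on [(y_j, e_(j+1))], in the order for which the
    factor [phi0(y_j) = phi(x_j)] is merely known to be bounded. *)
Lemma symmetric_ideal_weakly_null (k : scalar_field) (X : seq_class k) (p : R) :
  linearly_stable X -> 1 <= p -> symmetric_ideal (ell_w k p) X (ell k p) ->
  forall (E : Banach k) (x : nat -> E), sc_rule X E x -> c0_w k E x.
Proof.
  intros HX Hp Hsym E x Hx phi Hphi.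
  set (F := ell_infty k).
  set (A := fun f g : F => scal (scalar_val k (f O)) g).
  set (u := fun z : E => spike O (phi z) : F).
  assert (Hu : is_linear u).
  { exact (is_linear_comp phi (spike O) Hphi (is_linear_spike O)). }
  assert (HA : summing2 (ell_w k p) X (ell k p) F F F A).
  { apply (summing2_scal_functional k X p F F (fun f => f O)); [lra | apply is_linear_eval]. }
  destruct (HX E F u) as [[_ Hsum] _].
  destruct (Hsum Hu) as [_ Huy].
  destruct (Hsym F F A HA) as [_ Hell].
  specialize (Hell _ _ (unit_vectors_weakly_summable k p S Hp eq_add_S) (Huy x Hx)).
  apply ell_norm_lim_0 in Hell; [| lra].
  apply (@norm_lim_0 _ (scalar_space k)).
  (* The factor 2 undoes the 1/2 of the symmetrization. *)
  apply (is_lim_seq_scal_l _ 2) in Hell.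
  rewrite Rbar_mult_0_r in Hell.
  apply is_lim_seq_le_le with (3 := Hell) (u := fun _ => 0);
    [| apply is_lim_seq_const].
  intros j; split; [apply norm_ge_0 |].
  (* Coordinate [S j] of the symmetrized value already carries its whole norm. *)
  set (B := symmetrization A (unit_vector k (S j)) (u (x j))).
  assert (HB : (B : bfun nat (scalar_space k)) (S j) = scal (scalar_half k) (phi (x j))).
  { change (scal (scalar_half k) (plus
      (scal (scalar_val k (@zero (scalar_space k))) (@zero (scalar_space k)))
      (scal (scalar_val k (phi (x j))) (unit_vector k (S j) (S j))))
      = scal (scalar_half k) (phi (x j))).
    unfold unit_vector.
    rewrite spike_same, scal_scalar_one.
    apply (f_equal (scal (scalar_half k))).
    rewrite (@scal_zero_r _ (scalar_space k)).
    apply (@plus_zero_l (scalar_space k)). }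
  assert (H := norm_le_bnorm B (S j)).
  rewrite HB, norm_scal_scalar, abs_scalar_half in H.
  change (norm B) with (bnorm B); lra.
Qed.

Theorem proposition3p3 :
  forall (k : scalar_field) (X : seq_class k),
    linearly_stable X ->
    subsequence_invariant X ->
    (exists E : Banach k, ~ (forall x : nat -> E, sc_rule X E x -> c0_w k E x)) ->
    forall p : R, 1 <= p ->
      ~ symmetric_ideal (ell_w k p) X (ell k p).
Proof.
  intros k X HX _ [E HE] p Hp Hsym; apply HE.
  exact (symmetric_ideal_weakly_null k X p HX Hp Hsym E).
Qed.
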